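(* Let $D$ be a planar knotoid diagram. Then $$\sum_{c\in C(D)}u(c)=0.$$
   Context: **Knotoid diagrams.** A planar knotoid diagram $D$ is a generic immersion $f:[0,1]\to\mathbb{R}^2$ (its only multiple points are finitely many transverse double points, called crossings, distinct from $f(0)$ and $f(1)$) with over/under information at each crossing; it is oriented from $f(0)$ (the leg) to $f(1)$ (the head). $C(D)$ is the set of crossings. **Coloring number.** The arcs of $D$ are the closures of the components of $D\setminus C(D)$. A Cheng coloring assigns an integer to each arc so that, travelling along $D$, at each passage through a crossing (over or under) the label increases by $1$ if the curve crosses the other strand from right to left (with respect to that other strand's orientation) and decreases by $1$ if from left to right. It is unique up to an additive constant. At a crossing $c$, let $a$ be the label of the incoming arc of the strand crossing the other one from right to left (its outgoing arc has label $a+1$), and $b$ the label of the outgoing arc of the other strand (its incoming arc has label $b+1$). The coloring number is $u(c)=a-b$. *)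

(* Defs.v *)
From HB Require Import structures.
From mathcomp Require Import all_boot all_order all_algebra.
From mathcomp Require Import all_classical all_reals all_analysis.

Set Implicit Arguments.
Unset Strict Implicit.
Unset Printing Implicit Defensive.

Import Order.TTheory GRing.Theory Num.Theory.
Import numFieldNormedType.Exports.

Local Open Scope classical_set_scope.
Local Open Scope ring_scope.

Definition det2 (R : realType) (v w : R * R) : R := v.1 * w.2 - v.2 * w.1.

(* t and s are the two parameters at which f passes through the point c *)
Definition passages (R : realType) (f : R -> R * R) (c : R * R) (t s : R) :
    Prop :=
  [/\ t \in `[0, 1], s \in `[0, 1], t != s, f t = c & f s = c].

Definition crossings (R : realType) (f : R -> R * R) : set (R * R) :=
  [set c | exists t s, passages f c t s].

(* [0, 1] is the parameter interval; values of the fields outside it carry no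
   information.  The velocity is the derivative relative to [0, 1], hence
   one-sided at the endpoints, and it is continuous: f is a C^1 immersion. *)
Record knotoid_diagram (R : realType) := KnotoidDiagram {
  curve :> R -> R * R;
  velocity : R -> R * R;
  is_over : R -> bool;
  curve_velocity : forall t : R, t \in `[0, 1] ->
    (s - t)^-1 *: (curve s - curve t) @[s --> within `[0, 1] t^']
      --> velocity t;
  velocity_continuous : {within `[0, 1], continuous velocity};
  velocity_neq0 : forall t : R, t \in `[0, 1] -> velocity t != 0;
  crossings_finite : finite_set (crossings curve);
  no_triple_point : forall r s t : R,
    r \in `[0, 1] -> s \in `[0, 1] -> t \in `[0, 1] ->
    curve r = curve s -> curve s = curve t -> [|| r == s, s == t | r == t];
  crossings_transverse : forall (c : R * R) (t s : R),
    passages curve c t s -> det2 (velocity t) (velocity s) != 0;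
  leg_simple : forall t : R, t \in `[0, 1] -> curve t = curve 0 -> t = 0;
  head_simple : forall t : R, t \in `[0, 1] -> curve t = curve 1 -> t = 1;
  over_under : forall (c : R * R) (t s : R),
    passages curve c t s -> is_over t = ~~ is_over s }.

Section Coloring.
Context {R : realType}.
Implicit Types (D : knotoid_diagram R) (c : R * R) (s t : R).
Implicit Types (A B : set (R * R)) (lam : set (R * R) -> int).

Definition curve_image D : set (R * R) := D @` `[0, 1].

Definition is_arc D A : Prop :=
  exists2 p, (curve_image D `\` crossings D) p &
    A = closure (connected_component (curve_image D `\` crossings D) p).

Definition incoming_arc D t A : Prop :=
  is_arc D A /\ \forall r \near t^'-, A (D r).

Definition outgoing_arc D t A : Prop :=
  is_arc D A /\ \forall r \near t^'+, A (D r).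

(* the strand through D t crosses the strand through D s = D t from the right
   of the latter to its left *)
Definition right_to_left D t s : Prop := 0 < det2 (velocity D s) (velocity D t).

Definition left_to_right D t s : Prop := det2 (velocity D s) (velocity D t) < 0.

(* only the values of lam on the arcs of D matter *)
Definition cheng_coloring D lam : Prop :=
  forall c t s A B, passages D c t s ->
    incoming_arc D t A -> outgoing_arc D t B ->
    (right_to_left D t s -> lam B = lam A + 1) /\
    (left_to_right D t s -> lam B = lam A - 1).

Definition is_coloring_number D lam c (n : int) : Prop :=
  exists t s A B, [/\ passages D c t s, right_to_left D t s,
    incoming_arc D t A, outgoing_arc D s B & n = lam A - lam B].

Definition coloring_number D lam c : int :=
  xget 0 [set n | is_coloring_number D lam c n].

End Coloring.

(* Main.v *)
(** Cut [0, 1] at the passage parameters.  Each open gap is mapped into a single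
arc, so the label after a passage is the label before the next one, and for
every F the sum over all passages of F(label after) - F(label before)
telescopes to F(b) - F(a), where a and b are the first and last labels.  At a
crossing c the two passages change the label from p to p + 1 and from q + 1 to q,
with u(c) = p - q.  Taking F(x) = x gives a = b, since the two changes cancel;
taking F(x) = x^2 then gives 0 = \sum_c ((2p + 1) - (2q + 1)) = 2 \sum_c u(c). *)
Require Import Defs.
From HB Require Import structures.
From mathcomp Require Import all_boot all_order all_algebra.
From mathcomp Require Import all_classical all_reals all_analysis.
From mathcomp Require Import ring lra.

Import Order.TTheory GRing.Theory Num.Theory.
Import numFieldNormedType.Exports.

Local Open Scope classical_set_scope.
Local Open Scope ring_scope.

(** * Preliminaries on connected sets and sorted sequences *)

Lemma connected_between (T : topologicalType) (A B : set T) :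
  connected A -> A `<=` B -> B `<=` closure A -> connected B.
Proof.
move=> cA AB BA; apply/connectedP => E [E0 BE sE].
have AE : A `<=` E false `|` E true by rewrite -BE.
(* Connectedness puts [A] inside one side of the separation of [B]. Then [B] lies in the closure of
   that side, which misses the other, nonempty side. *)
have [/closureS AEf|/closureS AEt] := connected_subset sE AE cA.
  have [y Ey] := E0 true; have By : B y by rewrite BE; right.
  suff : set0 y by [].
  by rewrite -sE.1; split=> //; exact/AEf/BA.
have [y Ey] := E0 false; have By : B y by rewrite BE; left.
suff : set0 y by [].
by rewrite -sE.2; split=> //; exact/AEt/BA.
Qed.

(** A set between a connected set and its closure is connected, so maximality of the component
    absorbs the left-hand side. Hence the closure in the definition of an arc adds no regular
    point. *)
Lemma closure_connected_componentI (T : topologicalType) (S : set T) (p : T) :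
  closure (connected_component S p) `&` S = connected_component S p.
Proof.
apply/seteqP; split=> q; last first.
  move=> Cq; split; first exact: subset_closure.
  exact: connected_component_sub Cq.
move=> [cq Sq].
have [Sp|nSp] := pselect (S p); last first.
  by move: cq; rewrite connected_component_out // closure0.
apply: (@connected_component_max _ S
  (closure (connected_component S p) `&` S)) => //.
- by split=> //; exact/subset_closure/connected_component_refl.
- apply: (@connected_between _ (connected_component S p)) => //.
  + exact: component_connected.
  + by move=> r Cr; split; [exact: subset_closure|
      exact: connected_component_sub Cr].
Qed.

Lemma sum_telescope_sorted (T : eqType) (V : zmodType) (a b : T -> V)
    (x : T) (s : seq T) :
  path (fun y z => b y == a z) x s ->
  \sum_(y <- x :: s) (b y - a y) = b (last x s) - a x.
Proof.
elim: s x => [|y s IHs] x /=; first by rewrite big_seq1.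
case/andP=> /eqP bxay /IHs; rewrite big_cons => ->.
by rewrite bxay addrC addrA subrK.
Qed.

Lemma sorted_consecutive d (T : orderType d) (r : rel T) (s : seq T) :
  sorted <%O s ->
  {in s &, forall x y, (x < y)%O ->
    (forall z, z \in s -> ~~ (x < z < y)%O) -> r x y} ->
  sorted r s.
Proof.
case: s => // x0 s ss h; apply/(sortedP x0) => i ilt.
have lt_nth := lt_sorted_ltn_nth x0 ss.
apply: h; rewrite ?mem_nth ?lt_nth ?inE ?(ltnW ilt)//.
move=> z /(nthP x0)[j jlt <-]; rewrite !lt_nth ?inE ?(ltnW ilt)//.
by rewrite ltnS ltnNge andNb.
Qed.

(** * Arcs, and the gaps that are mapped into them *)

Section Knotoid.
Set Implicit Arguments.
Unset Strict Implicit.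
Context {R : realType} (D : knotoid_diagram R).

Definition regular_points : set (R * R) := curve_image D `\` crossings D.

(** Distinct arcs may meet at a crossing, but a regular point of an arc already lies in the
    component whose closure is that arc, and components sharing a point coincide. *)
Lemma is_arc_unique (A B : set (R * R)) p : is_arc D A -> is_arc D B ->
  regular_points p -> A p -> B p -> A = B.
Proof.
move=> [q Sq ->] [q' Sq' ->] Sp Ap Bp.
have Cq : connected_component regular_points q p.
  by rewrite -closure_connected_componentI.
have Cq' : connected_component regular_points q' p.
  by rewrite -closure_connected_componentI.
congr closure.
by rewrite (same_connected_component Cq) (same_connected_component Cq').
Qed.

(** At an interior parameter the limit relative to the unit interval is two-sided. Multiplying the
    difference quotient by [s - t], which tends to 0, shows that [D s - D t] tends to 0. *)
Lemma curve_continuous (t : R) : t \in `]0, 1[ -> {for t, continuous D}.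
Proof.
move=> t01; apply/continuous_withinNx.
have quot : (s - t)^-1 *: (D s - D t) @[s --> t^'] --> velocity D t.
  apply: cvg_trans (curve_velocity (subset_itv_oo_cc t01)).
  apply: cvg_app => A nA.
  have near01 : \forall s \near t^', s \in `]0, 1[.
    apply: nbhs_dnbhs; exact: near_in_itvoo.
  have {}nA : \forall s \near t^', s \in `[0, 1] -> A s by exact: nA.
  near=> s; suff : s \in `[0, 1] by near: s.
  by apply: subset_itv_oo_cc; near: s.
have step : (s - t) @[s --> t^'] --> (0 : R).
  rewrite -(subrr t); apply: cvgB; last exact: cvg_cst.
  exact: cvg_within.
suff : (s - t) *: ((s - t)^-1 *: (D s - D t)) + D t @[s --> t^']
    --> 0 *: velocity D t + D t.
  rewrite scale0r add0r; apply: cvg_trans; apply: near_eq_cvg.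
  near=> s; rewrite scalerA divff ?scale1r ?subrK// subr_eq0.
  by near: s; exact: nbhs_dnbhs_neq.
by apply: cvgD; [exact: cvgZ step quot|exact: cvg_cst].
Unshelve. all: by end_near. Qed.

(** The image of the open gap is connected and consists of regular points, so it lies in the
    component of the image of the midpoint. The closure of that component is the arc at both
    ends. *)
Lemma gap_arc (x y : R) : 0 <= x -> x < y -> y <= 1 ->
  (forall r, r \in `]x, y[ -> ~ crossings D (D r)) ->
  exists2 A, outgoing_arc D x A & incoming_arc D y A.
Proof.
move=> x0 xy y1 gap.
have sub01 r : r \in `]x, y[ -> r \in `]0, 1[.
  by rewrite !in_itv/= => /andP[? ?]; apply/andP; split; lra.
have mid : (x + y) / 2 \in `]x, y[ by rewrite in_itv/=; apply/andP; split; lra.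
have gapS : D @` `]x, y[ `<=` regular_points.
  move=> _ [r rxy <-]; split; last exact: gap.
  exists r => //; exact/subset_itv_oo_cc/sub01.
set C := connected_component regular_points (D ((x + y) / 2)).
have subC : D @` `]x, y[ `<=` closure C.
  apply: (@subset_trans _ C); last exact: subset_closure.
  apply: connected_component_max => //.
  apply: connected_continuous_connected.
    exact/connected_intervalP/interval_is_interval.
  apply: continuous_in_subspaceT => r; rewrite inE /= => rxy.
  exact/curve_continuous/sub01.
have arcC : is_arc D (closure C).
  by exists (D ((x + y) / 2)) => //; apply: gapS; exists ((x + y) / 2).
exists (closure C); split=> //.
  near=> r; apply: subC; exists r => //=; rewrite in_itv/=.
  by apply/andP; split; near: r; [exact: nbhs_right_gt|exact: nbhs_right_lt].
near=> r; apply: subC; exists r => //=; rewrite in_itv/=.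
by apply/andP; split; near: r; [exact: nbhs_left_gt|exact: nbhs_left_lt].
Unshelve. all: by end_near. Qed.

(** * Crossings and their passage parameters *)

Lemma passages_or c t s r : passages D c t s -> r \in `[0, 1] -> D r = c ->
  r = t \/ r = s.
Proof.
move=> [t01 s01 ts Dt Ds] r01 Dr.
have /or3P[/eqP->|/eqP->|/eqP tse] :=
  @no_triple_point _ D t r s t01 r01 s01 (etrans Dt (esym Dr))
    (etrans Dr (esym Ds)); [by left|by right|].
by rewrite tse eqxx in ts.
Qed.

Lemma passages_sym c t s : passages D c t s -> passages D c s t.
Proof. by move=> [? ? ? ? ?]; split; rewrite // eq_sym. Qed.

Lemma passages_in_oo c t s : passages D c t s -> t \in `]0, 1[.
Proof.
move=> [t01 s01 ts Dt Ds]; have DsDt : D s = D t by rewrite Ds Dt.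
have t0 : t != 0.
  by apply: contraNneq ts => t0; rewrite t0 (@leg_simple _ D s) // -t0.
have t1 : t != 1.
  by apply: contraNneq ts => t1; rewrite t1 (@head_simple _ D s) // -t1.
by move: t01; rewrite !in_itv/= !le_eqVlt eq_sym (negbTE t0) (negbTE t1).
Qed.

Lemma det2C (v w : R * R) : det2 v w = - det2 w v.
Proof. rewrite /det2; ring. Qed.

(** Transversality makes the determinant of the two velocities nonzero, and exchanging the strands
    changes its sign. So one order of the two parameters is right to left: [T c] comes first in it
    and [S c] second. *)
Lemma crossing_strands : exists T S : R * R -> R, forall c, crossings D c ->
  passages D c (T c) (S c) /\ right_to_left D (T c) (S c).
Proof.
have /choice[g gP] : forall c, exists ts : R * R, crossings D c ->
    passages D c ts.1 ts.2 /\ right_to_left D ts.1 ts.2.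
  move=> c; have [[t [s tsP]]|nc] := pselect (crossings D c); last first.
    (* An arbitrary value away from the crossings, where nothing is claimed. *)
    by exists 0.
  have := crossings_transverse tsP; rewrite neq_lt => /orP[lt0|gt0].
    by exists (t, s); split=> //; rewrite /right_to_left det2C oppr_gt0.
  by exists (s, t); split=> //; exact: passages_sym.
by exists (fst \o g), (snd \o g).
Qed.

Definition passage_times : set R := [set t | exists c s, passages D c t s].

Lemma finite_passage_times : finite_set passage_times.
Proof.
have [T [S TS]] := crossing_strands.
apply: (@sub_finite_set _ _ (T @` crossings D `|` S @` crossings D)).
  move=> t [c [s tsP]]; have cc : crossings D c by exists t, s.
  have [[t01 _ _ Dt _] [/passages_or TSP _]] := (tsP, TS c cc).
  by have [->|->] := TSP t t01 Dt; [left|right]; exists c.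
rewrite finite_setU; split; apply: finite_image; exact: crossings_finite.
Qed.

Lemma passage_timesP (t : R) : t \in `[0, 1] ->
  crossings D (D t) <-> passage_times t.
Proof.
move=> t01; split=> [[r [s rsP]]|[c [s tsP]]]; last first.
  by have [_ _ _ -> _] := tsP; exists t, s.
by have [->|->] := passages_or rsP t01 erefl; exists (D t);
  [exists s|exists r; exact: passages_sym].
Qed.

(** The passage parameters other than [t] form a finite, hence closed, set; its complement is a
    neighborhood of [t]. *)
Lemma near_not_passage t : \forall r \near t^', ~ passage_times r.
Proof.
have cl : closed (passage_times `\ t).
  have /accessible_finite_set_closed := hausdorff_accessible (@Rhausdorff R).
  by apply; exact/finite_setD/finite_passage_times.
have ot : nbhs t (~` (passage_times `\ t)).
  apply: open_nbhs_nbhs; split; first exact: closed_openC.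
  by move=> [_]; apply.
have {}ot := nbhs_dnbhs ot.
have nt := nbhs_dnbhs_neq t.
near=> r => Pr; have : (~` (passage_times `\ t)) r by near: r.
by apply; split=> //; apply/eqP; near: r.
Unshelve. all: by end_near. Qed.

(** * Existence and uniqueness of the arcs on either side of a parameter *)

Lemma passage_gap_arc (x y : R) : 0 <= x -> x < y -> y <= 1 ->
  (forall r, r \in `]x, y[ -> ~ passage_times r) ->
  exists2 A, outgoing_arc D x A & incoming_arc D y A.
Proof.
move=> x0 xy y1 gap; apply: gap_arc => // r rxy; rewrite passage_timesP.
  exact: gap.
by move: rxy; rewrite !in_itv/= => /andP[? ?]; apply/andP; split; lra.
Qed.

Lemma near_regular (t : R) : t \in `]0, 1[ ->
  \forall r \near t^', regular_points (D r).
Proof.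
move=> t01; have near01 : \forall r \near t^', r \in `]0, 1[.
  by apply: nbhs_dnbhs; exact: near_in_itvoo.
have np := near_not_passage t.
near=> r; have r01 : r \in `[0, 1] by apply: subset_itv_oo_cc; near: r.
split; first by exists r.
by rewrite passage_timesP//; near: r.
Unshelve. all: by end_near. Qed.

(** Both arcs contain [D r] for some [r] just before [t], and that point is regular. *)
Lemma incoming_arc_unique (t : R) A B : t \in `]0, 1[ ->
  incoming_arc D t A -> incoming_arc D t B -> A = B.
Proof.
move=> /near_regular reg [arcA nA] [arcB nB].
have {}reg : \forall r \near t^'-, regular_points (D r).
  by move: reg; apply: within_subset => r; rewrite /= => rt; rewrite lt_eqF.
near t^'- => r.
by apply: (@is_arc_unique A B (D r)) => //; near: r.
Unshelve. all: by end_near. Qed.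

Lemma outgoing_arc_unique (t : R) A B : t \in `]0, 1[ ->
  outgoing_arc D t A -> outgoing_arc D t B -> A = B.
Proof.
move=> /near_regular reg [arcA nA] [arcB nB].
have {}reg : \forall r \near t^'+, regular_points (D r).
  by move: reg; apply: within_subset => r; rewrite /= => rt; rewrite gt_eqF.
near t^'+ => r.
by apply: (@is_arc_unique A B (D r)) => //; near: r.
Unshelve. all: by end_near. Qed.

Lemma passage_free_neighborhood (t : R) : t \in `]0, 1[ ->
  exists2 e : R, 0 < e & [/\ 0 <= t - e, t + e <= 1 &
    forall r, r != t -> t - e < r < t + e -> ~ passage_times r].
Proof.
rewrite in_itv/= => /andP[t0 t1].
have [e /= e0 he] := near_not_passage t.
(* The bounds [t] and [1 - t] keep the neighborhood inside the unit interval. *)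
exists (Num.min e (Num.min t (1 - t))).
  by rewrite !lt_min e0 t0 subr_gt0.
split; rewrite ?subr_ge0 -?lerBrDl ?ge_min ?lexx ?orbT//.
move=> r rt; rewrite -ltr_distl !lt_min => /andP[re _]; apply: he => //=.
by rewrite distrC.
Qed.

Lemma incoming_arc_exists (t : R) : t \in `]0, 1[ ->
  exists A, incoming_arc D t A.
Proof.
move=> t01; have [e e0 [te0 _ free]] := passage_free_neighborhood t01.
have [||||A _ inA] := @passage_gap_arc (t - e) t _ _ _ _ => //; last by exists A.
- by rewrite ltrBlDr ltrDl.
- by move: t01; rewrite in_itv/= => /andP[_ /ltW].
move=> r; rewrite in_itv/= => /andP[r1 r2]; apply: free; first by rewrite lt_eqF.
by rewrite r1 (lt_trans r2)// ltrDl.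
Qed.

Lemma outgoing_arc_exists (t : R) : t \in `]0, 1[ ->
  exists A, outgoing_arc D t A.
Proof.
move=> t01; have [e e0 [_ te1 free]] := passage_free_neighborhood t01.
have [||||A outA _] := @passage_gap_arc t (t + e) _ _ _ _ => //; last by exists A.
- by move: t01; rewrite in_itv/= => /andP[/ltW].
- by rewrite ltrDl.
move=> r; rewrite in_itv/= => /andP[r1 r2]; apply: free; first by rewrite gt_eqF.
by rewrite r2 andbT (lt_trans _ r1)// ltrBlDr ltrDl.
Qed.

(** * Labels as functions of the parameter *)

Context (lam : set (R * R) -> int).

(** The coloring labels sets of points, whereas telescoping needs labels indexed by parameters. For
    [t] strictly between 0 and 1 the incoming arc exists and is unique, so the default [set0] is not
    reached. *)
Definition label_before (t : R) : int :=
  lam (xget set0 [set A | incoming_arc D t A]).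

Definition label_after (t : R) : int :=
  lam (xget set0 [set A | outgoing_arc D t A]).

Lemma label_beforeE (t : R) A : t \in `]0, 1[ -> incoming_arc D t A ->
  label_before t = lam A.
Proof.
move=> t01 inA; congr lam; apply: xget_subset1 => // B C.
exact: incoming_arc_unique.
Qed.

Lemma label_afterE (t : R) A : t \in `]0, 1[ -> outgoing_arc D t A ->
  label_after t = lam A.
Proof.
move=> t01 outA; congr lam; apply: xget_subset1 => // B C.
exact: outgoing_arc_unique.
Qed.

Lemma label_after_before (x y : R) : passage_times x -> passage_times y ->
  x < y -> (forall r, r \in `]x, y[ -> ~ passage_times r) ->
  label_after x = label_before y.
Proof.
move=> [c [s /passages_in_oo x01]] [c' [s' /passages_in_oo y01]] xy gap.
move: (x01) (y01); rewrite !in_itv/= => /andP[x0 _] /andP[_ y1].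
have [A outA inA] := passage_gap_arc (ltW x0) xy (ltW y1) gap.
by rewrite (label_afterE x01 outA) (label_beforeE y01 inA).
Qed.

Lemma label_jump c t s : cheng_coloring D lam -> passages D c t s ->
  (right_to_left D t s -> label_after t = label_before t + 1) /\
  (left_to_right D t s -> label_after t = label_before t - 1).
Proof.
move=> hlam ts; have t01 := passages_in_oo ts.
have [A inA] := incoming_arc_exists t01.
have [B outB] := outgoing_arc_exists t01.
rewrite (label_afterE t01 outB) (label_beforeE t01 inA).
exact: hlam ts inA outB.
Qed.

Lemma right_to_left_flip t s : right_to_left D t s -> left_to_right D s t.
Proof. by rewrite /right_to_left /left_to_right det2C oppr_gt0. Qed.

(** The coloring number is defined by choice, so uniqueness is needed: the crossing has only two
    parameters, and their right-to-left order is forced by the sign of the determinant. *)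
Lemma coloring_numberE c t s : passages D c t s -> right_to_left D t s ->
  coloring_number D lam c = label_before t - label_after s.
Proof.
move=> ts rl; have t01 := passages_in_oo ts.
have s01 := passages_in_oo (passages_sym ts).
have [A inA] := incoming_arc_exists t01.
have [B outB] := outgoing_arc_exists s01.
suff unique n : is_coloring_number D lam c n ->
    n = label_before t - label_after s.
  apply: xget_subset1; last by move=> m n /unique-> /unique->.
  exists t, s, A, B; split=> //.
  by rewrite (label_afterE s01 outB) (label_beforeE t01 inA).
move=> [t' [s' [A' [B' [ts' rl' inA' outB' ->]]]]].
have t'01 := passages_in_oo ts'.
have s'01 := passages_in_oo (passages_sym ts').
rewrite -(label_afterE s'01 outB') -(label_beforeE t'01 inA').
have [cc1 cc2 cc3 cc4 cc5] := ts'.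
have [et|et] := passages_or ts cc1 cc4; have [es|es] := passages_or ts cc2 cc5.
- by rewrite et es eqxx in cc3.
- by rewrite et es.
(* With the strands exchanged, the same determinant would be both positive and negative. *)
- by move/right_to_left_flip: rl'; rewrite et es => /(lt_trans rl); rewrite ltxx.
- by rewrite et es eqxx in cc3.
Qed.

(** * Summation over all passages *)

Lemma passage_times_enum (T S : R * R -> R) :
  (forall c, crossings D c -> passages D c (T c) (S c)) ->
  let X := finmap.enum_fset (fset_set (crossings D)) in
  let p := [seq T c | c <- X] ++ [seq S c | c <- X] in
  uniq p /\ forall t, (t \in p) <-> passage_times t.
Proof.
move=> TS X p.
have XP c : c \in X <-> crossings D c.
  by rewrite in_fset_set ?inE//; exact: crossings_finite.
(* The crossing is recovered from either of its parameters by applying [D]. *)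
have injT : {in X &, injective T}.
  move=> c c' /XP/TS[_ _ _ Tc _] /XP/TS[_ _ _ Tc' _] TT.
  by rewrite -Tc -Tc' TT.
have injS : {in X &, injective S}.
  move=> c c' /XP/TS[_ _ _ _ Sc] /XP/TS[_ _ _ _ Sc'] SS.
  by rewrite -Sc -Sc' SS.
split.
  rewrite cat_uniq !map_inj_in_uniq// finmap.fset_uniq/= andbT.
  (* A parameter common to both lists would belong to a single crossing [c] with [T c = S c]. *)
  apply/hasPn => _ /mapP[c /XP/TS[_ _ _ _ Sc] ->].
  apply/negP => /mapP[c' /XP/TS[_ _ TS' Tc' _] ST].
  have cc' : c = c' by rewrite -Sc -Tc' ST.
  by rewrite -ST cc' eqxx in TS'.
move=> t; rewrite mem_cat; split.
  case/orP=> /mapP[c /XP/TS ts ->]; first by exists c, (S c).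
  by exists c, (T c); exact: passages_sym.
move=> [c [s ts]]; have cc : crossings D c by exists t, s.
have [t01 _ _ Dt _] := ts.
by have [->|->] := passages_or (TS c cc) t01 Dt;
  rewrite map_f ?orbT//; exact/XP.
Qed.

(** After sorting, adjacent parameters bound a passage-free gap, so the sum telescopes. The end
    labels are chosen before [F], so that two choices of [F] can be compared. *)
Lemma sum_label_jumps (p : seq R) : uniq p ->
  (forall t, (t \in p) <-> passage_times t) ->
  exists a b : int, forall F : int -> int,
    \sum_(t <- p) (F (label_after t) - F (label_before t)) = F b - F a.
Proof.
move=> up pP; pose q := sort <=%O p.
have qP t : t \in q <-> passage_times t by rewrite mem_sort.
have sq : sorted <%O q by rewrite sort_lt_sorted.
have /sorted_consecutive : {in q &, forall x y, x < y ->
    (forall z, z \in q -> ~~ (x < z < y)) -> label_after x == label_before y}.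
  move=> x y /qP Px /qP Py xy gap; apply/eqP/label_after_before => // r rxy.
  by move=> /qP /gap/negP; apply; move: rxy; rewrite in_itv.
move=> /(_ sq) jumps.
have sumE F : \sum_(t <- p) (F (label_after t) - F (label_before t)) =
    \sum_(t <- q) (F (label_after t) - F (label_before t)) :> int.
  by apply: perm_big; rewrite perm_sym perm_sort.
case: q sumE jumps {qP sq} => [|x q] sumE jumps.
  (* Without passages the sum is empty, and any two equal labels serve. *)
  by exists 0, 0 => F; rewrite sumE big_nil subrr.
exists (label_before x), (label_after (last x q)) => F; rewrite sumE.
apply: (sum_telescope_sorted _ _ (F \o label_before) (F \o label_after)).
by apply: sub_path jumps => y z /eqP /= ->.
Qed.

End Knotoid.

Theorem proposition3p2 (R : realType) (D : knotoid_diagram R)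
    (lam : set (R * R) -> int) (hlam : cheng_coloring D lam) :
  \sum_(c \in crossings D) coloring_number D lam c = 0.
Proof.
have [T [S TS]] := crossing_strands D.
have fin := @crossings_finite _ D.
have [up pP] := passage_times_enum (fun c cc => (TS c cc).1).
have [a [b jumps]] := sum_label_jumps lam up pP.
rewrite fsbig_finite//; set X := finmap.enum_fset _ in jumps *.
have XP c : c \in X -> crossings D c by rewrite in_fset_set ?inE.
(* The sum over passages is regrouped by crossing, pairing the two strands. *)
have split_sum (F : int -> int) : \sum_(c <- X)
    (F (label_after D lam (T c)) - F (label_before D lam (T c)) +
     (F (label_after D lam (S c)) - F (label_before D lam (S c)))) = F b - F a.
  by rewrite -jumps big_cat/= !big_map -big_split.
have jumpT c : c \in X ->
    label_after D lam (T c) = label_before D lam (T c) + 1.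
  by move=> /XP/TS[ts rl]; exact: (label_jump hlam ts).1.
have jumpS c : c \in X ->
    label_after D lam (S c) = label_before D lam (S c) - 1.
  move=> /XP/TS[/passages_sym st /right_to_left_flip].
  exact: (label_jump hlam st).2.
have ab : b = a.
  apply/eqP; rewrite -subr_eq0 -(split_sum id) big_seq big1// => c cX.
  by rewrite jumpT// jumpS//; ring.
have sum2 : (\sum_(c <- X) coloring_number D lam c) *+ 2 = 0.
  (* Since [a = b], the right-hand 0 can be written [b ^+ 2 - a ^+ 2], the telescoped sum for
     squaring. *)
  rewrite -[RHS](subrr (b ^+ 2)) [in X in _ - X]ab.
  rewrite -(split_sum (fun x => x ^+ 2)).
  rewrite -sumrMnl; apply: eq_big_seq => c cX.
  have [ts rl] := TS c (XP c cX).
  by rewrite (coloring_numberE lam ts rl) jumpT// jumpS//; ring.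
by apply/eqP; move/eqP: sum2; rewrite mulrn_eq0.
Qed.
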